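(* Let $G$ be a finite, simple, connected bipartite graph and let $I_G$ be its toric ideal over a field $K$. Then $\mathrm{Split}(I_G)=\mathrm{Split}_{\mathrm{rad}}(I_G)$.
   Context: Let $G$ have vertices $v_1,\ldots,v_n$ and edges $e_1,\ldots,e_m$. To an edge $e=\{v_i,v_j\}$ associate ${\bf a}_e\in\{0,1\}^n$ with entries $1$ in positions $i,j$ and $0$ elsewhere. $I_G\subset K[e_1,\ldots,e_m]$ is the toric ideal of $A_G=\{{\bf a}_e\mid e\in E(G)\}$, i.e. the kernel of $K[e_1,\ldots,e_m]\to K[t_1,\ldots,t_n]$, $e_i\mapsto{\bf t}^{{\bf a}_{e_i}}$. For a toric ideal $I_A$ (of a configuration $A$ of $N$ integer vectors with $\ker_{\mathbb{Z}}(A)\cap\mathbb{N}^N=\{{\bf 0}\}$) in $K[x_1,\ldots,x_N]$: $\mathrm{Split}(I_A)$ is the smallest integer $s$ such that there exist toric ideals $I_{A_1},\ldots,I_{A_s}$ in the same polynomial ring with $I_A=I_{A_1}+\cdots+I_{A_s}$ and $I_{A_i}\ne I_A$ for all $i$; $\mathrm{Split}_{\mathrm{rad}}(I_A)$ is the smallest integer $r$ such that there exist toric ideals $I_{A_1},\ldots,I_{A_r}$ with $I_A=\mathrm{rad}(I_{A_1}+\cdots+I_{A_r})$ and $I_{A_i}\ne I_A$ for all $i$. *)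

(* Defs.v *)
From HB Require Import structures.
From mathcomp Require Import all_boot all_order all_algebra.
From mathcomp Require Import mpoly.
Set Implicit Arguments. Unset Strict Implicit. Unset Printing Implicit Defensive.
Import Order.TTheory GRing.Theory Num.Theory.
Local Open Scope ring_scope.

(* A configuration of N integer vectors in Z^d: column j is (A j : 'I_d -> int). *)
Definition config (N d : nat) := 'I_N -> 'I_d -> int.

Definition positive_config (N d : nat) (A : config N d) : Prop :=
  forall u : 'I_N -> nat,
    (forall k : 'I_d, \sum_(j < N) (u j)%:Z * A j k = 0) -> forall j, u j = 0%N.

(* Toric ideal I_A = kernel of K[x_1..x_N] -> K[t^{±1}], x_j |-> t^{a_j}.
   f = sum_u c_u x^u maps to sum_u c_u t^{Au}, which is zero iff for every
   b in Z^d the sum of the c_u with Au = b vanishes. *)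
Definition toric_ideal (K : fieldType) (N d : nat) (A : config N d)
    (f : {mpoly K[N]}) : Prop :=
  forall b : 'I_d -> int,
    \sum_(u <- msupp f | [forall k : 'I_d, \sum_(j < N) (u j)%:Z * A j k == b k])
       f@_u = 0.

Arguments toric_ideal K [N d] A f.

Definition ideal_eq (K : fieldType) (N : nat) (I J : {mpoly K[N]} -> Prop) : Prop :=
  forall f, I f <-> J f.

Definition ideal_sum (K : fieldType) (N s : nat) (I : 'I_s -> {mpoly K[N]} -> Prop)
    (f : {mpoly K[N]}) : Prop :=
  exists g : 'I_s -> {mpoly K[N]}, (forall i, I i (g i)) /\ f = \sum_(i < s) g i.

Definition radical (K : fieldType) (N : nat) (I : {mpoly K[N]} -> Prop)
    (f : {mpoly K[N]}) : Prop :=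
  exists k : nat, I (f ^+ k).

Definition has_splitting (K : fieldType) (N d : nat) (A : config N d) (s : nat) : Prop :=
  (0 < s)%N /\
  exists (dd : 'I_s -> nat) (B : forall i : 'I_s, config N (dd i)),
    (forall i, positive_config (B i)) /\
    (forall i, ~ ideal_eq (toric_ideal K (B i)) (toric_ideal K A)) /\
    ideal_eq (toric_ideal K A) (ideal_sum (fun i => toric_ideal K (B i))).

Definition has_rad_splitting (K : fieldType) (N d : nat) (A : config N d) (s : nat) : Prop :=
  (0 < s)%N /\
  exists (dd : 'I_s -> nat) (B : forall i : 'I_s, config N (dd i)),
    (forall i, positive_config (B i)) /\
    (forall i, ~ ideal_eq (toric_ideal K (B i)) (toric_ideal K A)) /\
    ideal_eq (toric_ideal K A) (radical (ideal_sum (fun i => toric_ideal K (B i)))).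

Definition is_least (P : nat -> Prop) (s : nat) : Prop :=
  P s /\ forall t, P t -> (s <= t)%N.

Definition Split_is (K : fieldType) (N d : nat) (A : config N d) (s : nat) : Prop :=
  is_least (has_splitting K A) s.
Definition Split_rad_is (K : fieldType) (N d : nat) (A : config N d) (s : nat) : Prop :=
  is_least (has_rad_splitting K A) s.

(* Graphs: vertices 'I_n, edges e_0..e_{m-1} given by their endpoint sets. *)
Definition simple_graph (n m : nat) (E : 'I_m -> {set 'I_n}) : Prop :=
  (forall j, #|E j| = 2%N) /\ injective E.

Definition adjacent (n m : nat) (E : 'I_m -> {set 'I_n}) : rel 'I_n :=
  fun x y => [exists j : 'I_m, (x \in E j) && (y \in E j) && (x != y)].

Definition connected_graph (n m : nat) (E : 'I_m -> {set 'I_n}) : Prop :=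
  forall x y : 'I_n, connect (adjacent E) x y.

Definition bipartite_graph (n m : nat) (E : 'I_m -> {set 'I_n}) : Prop :=
  exists c : 'I_n -> bool, forall j : 'I_m, forall x y, x \in E j -> y \in E j -> x != y -> c x != c y.

Definition graph_config (n m : nat) (E : 'I_m -> {set 'I_n}) : config m n :=
  fun j i => if i \in E j then 1%:Z else 0%:Z.

(* Main.v *)
Require Import Defs.
From HB Require Import structures.
From mathcomp Require Import all_boot all_order all_algebra.
From mathcomp Require Import mpoly zify.
Set Implicit Arguments.
Unset Strict Implicit.
Unset Printing Implicit Defensive.
Import Order.TTheory GRing.Theory Num.Theory.

(* Every radical splitting of I_G is already a splitting, and conversely.
   The converse holds because I_G is prime. For the direct part, let
   J = I_{A_1} + ... + I_{A_s} have radical I_G; one shows x^u - x^v in J for all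
   u, v of equal degree, by induction on the degree. Monomials of the fibre of u
   that share a variable are congruent modulo J by induction, so it suffices to
   find a monomial w in the fibre sharing a variable with u and with v. Exchanging
   along an alternating cycle of u and v yields such a w unless u and v are the two
   halves of that cycle, and a chord of the cycle again yields one. If the cycle C is
   chordless, every fibre of a monomial supported on C is a segment in direction
   u - v. If moreover u - v lay in no ker A_i, then monomials supported on C would
   be alone in their A_i-fibres, so could not occur in J, whereas
   (x^u - x^v)^k is a nonzero element of J supported on C. *)

(** * Minimal stable sets of a self-map *)

(** The minimal sets with this property are the cycles of [f]. *)
Definition stable_set (T : finType) (f : T -> T) (O : {set T}) : bool :=
  (O != set0) && (f @: O \subset O).

Lemma stable_setP (T : finType) (f : T -> T) (O : {set T}) :
  reflect (O != set0 /\ {in O, forall x, f x \in O}) (stable_set f O).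
Proof.
apply: (iffP andP) => -[O0 fO]; split=> //.
  by move=> x xO; apply: (subsetP fO); apply: imset_f.
by apply/subsetP => _ /imsetP[x xO ->]; apply: fO.
Qed.

(** The image of [O] is again stable, so minimality forbids a proper subset; [f] then permutes the
    finite set [O]. *)
Lemma minset_stable_imset (T : finType) (f : T -> T) (O : {set T}) :
  minset (stable_set f) O -> f @: O = O.
Proof.
case/minsetP => /andP[O0 fO] minO; apply: minO => //.
rewrite /stable_set imset_eq0 O0 /=; exact: imsetS.
Qed.

Lemma minset_stable_inj (T : finType) (f : T -> T) (O : {set T}) :
  minset (stable_set f) O -> {in O &, injective f}.
Proof. by move/minset_stable_imset => fO; apply/imset_injP; rewrite fO. Qed.

Lemma minset_stable_sub (T : finType) (f : T -> T) (O Q : {set T}) :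
    minset (stable_set f) O -> Q \subset O -> Q != set0 ->
  {in Q, forall x, f x \in Q} -> Q = O.
Proof.
case/minsetP => _ minO QO Q0 fQ; apply: minO => //.
exact/stable_setP.
Qed.

(** * Edge multisets and their vertex degrees *)

(* Edges of a bipartite graph are the elements of ['I_m]; [L] and [R] give
   the end of an edge in either colour class, and a monomial [u] is seen as a
   multiset of edges. *)
Definition vdeg (T : finType) (m : nat) (p : 'I_m -> T) (u : 'X_{1..m}) (x : T)
  : nat := \sum_(j | p j == x) u j.

Definition same_deg (T : finType) (m : nat) (L R : 'I_m -> T)
    (u v : 'X_{1..m}) : Prop :=
  vdeg L u =1 vdeg L v /\ vdeg R u =1 vdeg R v.

Lemma same_deg_sym (T : finType) (m : nat) (L R : 'I_m -> T) u v :
  same_deg L R u v -> same_deg L R v u.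
Proof. by case=> hL hR; split=> x; rewrite ?hL ?hR. Qed.

Lemma same_deg_trans (T : finType) (m : nat) (L R : 'I_m -> T) u v w :
  same_deg L R u v -> same_deg L R v w -> same_deg L R u w.
Proof. by case=> hL hR [kL kR]; split=> x; rewrite ?hL ?hR ?kL ?kR. Qed.

(** On an alternating cycle, taking [h] to be [id] or [b] gives the monomials of its two
    matchings. *)
Definition mset (m : nat) (S : {set 'I_m}) (h : 'I_m -> 'I_m) : 'X_{1..m} :=
  (\sum_(i in S) U_(h i))%MM.

Lemma vdegD (T : finType) (m : nat) (p : 'I_m -> T) u v x :
  vdeg p (u + v)%MM x = vdeg p u x + vdeg p v x.
Proof. by rewrite /vdeg -big_split; apply: eq_bigr => j _; rewrite mnmDE. Qed.

Lemma vdegU (T : finType) (m : nat) (p : 'I_m -> T) j x :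
  vdeg p U_(j)%MM x = (p j == x).
Proof.
rewrite /vdeg; under eq_bigr do rewrite mnm1E.
rewrite big_mkcond (bigD1 j) //= eqxx big1 ?addn0; first by case: (_ == x).
by move=> i /negPf; rewrite eq_sym => ->; case: ifP.
Qed.

Lemma vdeg_mset (T : finType) (m : nat) (p : 'I_m -> T) S h x :
  vdeg p (mset S h) x = \sum_(i in S) (p (h i) == x).
Proof.
rewrite /vdeg.
under eq_bigr do rewrite mnm_sumE.
by rewrite exchange_big; apply: eq_bigr => i _; rewrite -vdegU.
Qed.

Lemma msetE (m : nat) (S : {set 'I_m}) h j :
  {in S &, injective h} -> mset S h j = (j \in h @: S).
Proof.
move=> hinj; rewrite mnm_sumE; under eq_bigr do rewrite mnm1E.
case: imsetP => [[i iS ->]|hn].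
  rewrite (bigD1 i) //= eqxx big1 ?addn0 // => k /andP[kS ki].
  by rewrite (inj_in_eq hinj) // (negPf ki).
by rewrite big1 // => i iS; case: eqP => // e; case: hn; exists i.
Qed.

Lemma mset_gt0 (m : nat) (S : {set 'I_m}) h j :
  j \in S -> 0 < mset S h (h j).
Proof.
by move=> jS; rewrite mnm_sumE (bigD1 j) //= mnm1E eqxx.
Qed.

Lemma vdeg_gt0 (T : finType) (m : nat) (p : 'I_m -> T) (u : 'X_{1..m}) j :
  0 < u j -> 0 < vdeg p u (p j).
Proof. by move=> uj; rewrite /vdeg (bigD1 j) //= ltn_addr. Qed.

Lemma vdeg_gt0P (T : finType) (m : nat) (p : 'I_m -> T) (u : 'X_{1..m}) x :
  0 < vdeg p u x -> exists2 j, 0 < u j & p j = x.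
Proof.
case: (pickP (fun j => (0 < u j) && (p j == x))) => [j /andP[uj /eqP] ?|h].
  by exists j.
rewrite /vdeg big1 // => j pj; have := h j; rewrite pj andbT.
by case: (u j).
Qed.

Lemma vdeg_eq0 (T : finType) (m : nat) (p : 'I_m -> T) (u : 'X_{1..m}) :
  vdeg p u =1 (fun=> 0) -> u = 0%MM.
Proof.
move=> h; apply/mnmP => j; rewrite mnm0E; apply/eqP; rewrite -leqn0 leqNgt.
by apply/negP => /(vdeg_gt0 p); rewrite h.
Qed.

Lemma same_degDl (T : finType) (m : nat) (L R : 'I_m -> T) w u v :
  same_deg L R (w + u)%MM (w + v)%MM <-> same_deg L R u v.
Proof.
split=> -[hL hR]; split=> x; have := hL x; have := hR x;
  rewrite ?vdegD; lia.
Qed.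

(** * Alternating cycles *)

(* [O] and [b @: O] are the two perfect matchings making up the cycle, which is
   traversed as [x], [b x], [f x], [b (f x)], ... *)
Definition alternating_cycle (T : finType) (m : nat) (L R : 'I_m -> T)
    (O : {set 'I_m}) (b f : 'I_m -> 'I_m) : Prop :=
  [/\ minset (stable_set f) O, {in O, forall x, R (b x) = R x},
      {in O, forall x, L (b x) = L (f x)}, {in O &, injective L} &
      {in O &, injective R}].

Lemma alternating_cycle_injb (T : finType) (m : nat) (L R : 'I_m -> T) O b f :
  alternating_cycle L R O b f -> {in O &, injective b}.
Proof.
case=> _ bR _ _ injR x y xO yO bxy; apply: injR => //.
by rewrite -bR // bxy bR.
Qed.

(* Walk from an edge of [u] to an edge of [v] through the [R]-end, then back to
   an edge of [u] through the [L]-end; the choices depend only on the vertex, so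
   a minimal set stable under this walk is a simple alternating cycle. *)
Lemma exists_alternating_cycle (T : finType) (m : nat) (L R : 'I_m -> T)
    (u v : 'X_{1..m}) :
    same_deg L R u v -> u != 0%MM ->
  exists O b f, [/\ alternating_cycle L R O b f, {in O, forall x, 0 < u x} &
                    {in O, forall x, 0 < v (b x)}].
Proof.
move=> [hL hR] u0.
have [j0 uj0] : exists j, 0 < u j.
  apply/existsP; apply: contraNT u0; rewrite negb_exists => /forallP h.
  by apply/eqP/mnmP => j; rewrite mnm0E; have := h j; lia.
(* The default [j0] is used only at vertices missed by [u] (for [A]) or by [v] (for [B]). *)
pose A x := odflt j0 [pick e | (0 < u e) && (L e == x)].
pose B y := odflt j0 [pick e | (0 < v e) && (R e == y)].
have AP e : 0 < v e -> 0 < u (A (L e)) /\ L (A (L e)) = L e.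
  move=> /(vdeg_gt0 L); rewrite -hL => /vdeg_gt0P[e' ue' Le'].
  rewrite /A; case: pickP => [k /andP[uk /eqP]|/(_ e')] //.
  by rewrite ue' Le' eqxx.
have BP e : 0 < u e -> 0 < v (B (R e)) /\ R (B (R e)) = R e.
  move=> /(vdeg_gt0 R); rewrite hR => /vdeg_gt0P[e' ue' Le'].
  rewrite /B; case: pickP => [k /andP[uk /eqP]|/(_ e')] //.
  by rewrite ue' Le' eqxx.
pose b e := B (R e); pose f e := A (L (b e)).
have Sst : stable_set f [set e | 0 < u e].
  apply/stable_setP; split; first by apply/set0Pn; exists j0; rewrite inE.
  by move=> e; rewrite !inE => /BP[/AP[]].
have [O minO OS] := minset_exists Sst.
have uO x : x \in O -> 0 < u x by move/(subsetP OS); rewrite inE.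
have injf := minset_stable_inj minO.
exists O, b, f; split=> // [|x /uO /BP[]//].
split=> // [x /uO /BP[]//|x /uO /BP[/AP[]]//|x y|x y xO yO e].
  (* Edges of [O] are values of [f], and [f x] is determined by the [L]-end of [b x], which it
     keeps. *)
  rewrite -{1 2}(minset_stable_imset minO) => /imsetP[x' xO ->] /imsetP[y' yO ->].
  have [/AP[_ ex] _] := BP _ (uO _ xO); have [/AP[_ ey] _] := BP _ (uO _ yO).
  by rewrite {1}/f {1}/f ex ey /f => ->.
by apply: injf => //; rewrite /f /b e.
Qed.

(** [R]-degrees agree edge by edge, [L]-degrees after reindexing along the permutation [f] of
    [P]. *)
Lemma same_deg_reroute (T : finType) (m : nat) (L R : 'I_m -> T) (P : {set 'I_m})
    (b f : 'I_m -> 'I_m) :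
    {in P &, injective f} -> f @: P = P ->
    {in P, forall x, R (b x) = R x} -> {in P, forall x, L (b x) = L (f x)} ->
  same_deg L R (mset P id) (mset P b).
Proof.
move=> injf fP bR bL; split=> x; rewrite !vdeg_mset.
  rewrite -{1}fP big_imset //=; apply: eq_bigr => i iP.
  by rewrite bL.
by apply: eq_bigr => i iP; rewrite bR.
Qed.

Lemma alternating_cycle_same_deg (T : finType) (m : nat) (L R : 'I_m -> T) O b f :
  alternating_cycle L R O b f -> same_deg L R (mset O id) (mset O b).
Proof.
case=> minO bR bL _ _; apply: same_deg_reroute bR bL.
  exact: minset_stable_inj.
exact: minset_stable_imset.
Qed.

(* A chord [e] from [L p] to [R q] short-circuits the cycle: sending [q] to [p]
   instead of [f q], a minimal stable subset of [O] is the alternating cycle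
   through [e], and it misses [f q]. *)
Lemma alternating_cycle_chord (T : finType) (m : nat) (L R : 'I_m -> T)
    O b f (p q e : 'I_m) :
    (forall i j, L i = L j -> R i = R j -> i = j) ->
    alternating_cycle L R O b f -> p \in O -> q \in O ->
    L e = L p -> R e = R q -> e \notin O -> e \notin b @: O ->
  exists w, exists2 x, x \in O & exists2 y, y \in O &
    [/\ same_deg L R (mset O id) w, 0 < w x & 0 < w (b y)].
Proof.
move=> injLR cyc pO qO Lep Req eO ebO.
have [minO bR bL _ _] := cyc.
have [/minsetp /stable_setP[_ fO] injf] := (minO, minset_stable_inj minO).
have pq : p != q.
  apply: contraNneq eO => pq; suff -> : e = p by [].
  by apply: injLR; rewrite // pq.
have fqp : f q != p.
  apply: contraNneq ebO => fqp; suff -> : e = b q by apply: imset_f.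
  by apply: injLR; rewrite ?bL ?bR // fqp.
pose f' x := if x == q then p else f x.
pose b' x := if x == q then e else b x.
have Ost : stable_set f' O.
  apply/stable_setP; split; first by apply/set0Pn; exists p.
  by move=> x xO; rewrite /f'; case: ifP => // _; apply: fO.
have [P minP PO] := minset_exists Ost.
have PinO x : x \in P -> x \in O by move/(subsetP PO).
have fP := minset_stable_imset minP.
have [P0 f'P] : P != set0 /\ {in P, forall x, f' x \in P}.
  exact/stable_setP/(minsetp minP).
(* Otherwise [f'] agrees with [f] on [P], and minimality of [O] forces [P = O]. *)
have qP : q \in P.
  apply/negPn/negP => qP; suff PeO : P = O by rewrite PeO qO in qP.
  apply: (minset_stable_sub minO) => // x xP.
  by have := f'P x xP; rewrite /f'; case: eqP => // xq; rewrite -xq xP in qP.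
have pP : p \in P by have := f'P q qP; rewrite /f' eqxx.
have fqP : f q \notin P.
  apply/negP; rewrite -{1}fP => /imsetP[x xP]; rewrite /f'.
  case: eqP => [_ /eqP|xq /injf h]; first by rewrite (negPf fqp).
  by apply: xq; rewrite h ?PinO.
(* [P] is rerouted and the rest of [O] kept: [f q] survives from [O], and [b p] enters since [b']
   agrees with [b] at [p]. *)
exists (mset (O :\: P) id + mset P b')%MM, (f q); first exact: fO.
exists p => //; split.
- have -> : mset O id = (mset (O :\: P) id + mset P id)%MM.
    rewrite /mset (big_setID P) /= addmC.
    by congr (_ + _)%MM; rewrite (setIidPr PO).
  apply/same_degDl; apply: (@same_deg_reroute _ _ _ _ _ _ f') => //.
  + exact: minset_stable_inj.
  + by move=> x xP; rewrite /b'; case: eqP => [->|_] //; apply/bR/PinO.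
  + by move=> x xP; rewrite /b' /f'; case: eqP => // _; apply/bL/PinO.
- by rewrite mnmDE ltn_addr // (@mset_gt0 _ _ id) // !inE fqP fO.
- have -> : b p = b' p by rewrite /b' (negPf pq).
  by rewrite mnmDE addnC ltn_addr // mset_gt0.
Qed.

Lemma vdeg_two (T : finType) (m : nat) (p : 'I_m -> T) (a : 'X_{1..m}) x y :
    x != y -> p y = p x ->
    (forall j, 0 < a j -> p j = p x -> j = x \/ j = y) ->
  vdeg p a (p x) = a x + a y.
Proof.
move=> xy pxy h; rewrite /vdeg (bigD1 x) //= (bigD1 y) /=; last first.
  by rewrite pxy eqxx eq_sym.
rewrite big1 ?addn0 // => j /andP[/andP[/eqP pj jx] jy].
apply/eqP; rewrite -leqn0 leqNgt; apply/negP => /h /(_ pj).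
by case=> e; rewrite e eqxx in jx jy.
Qed.

(* Without chords [a'] lives on the cycle too, and [a - a'] is [f]-invariant on
   [O]; by minimality of [O] its level sets are trivial. *)
Lemma alternating_cycle_kernel (T : finType) (m : nat) (L R : 'I_m -> T)
    O b f (a a' : 'X_{1..m}) :
    alternating_cycle L R O b f -> [disjoint O & b @: O] ->
    (forall p q e, p \in O -> q \in O -> L e = L p -> R e = R q ->
       (e \in O) || (e \in b @: O)) ->
    (forall j, 0 < a j -> (j \in O) || (j \in b @: O)) ->
    same_deg L R a a' ->
  exists D : int, forall j : 'I_m,
    ((a j)%:Z - (a' j)%:Z = D * ((mset O id j)%:Z - (mset O b j)%:Z))%R.
Proof.
move=> cyc dis nochord aC [hL hR].
have injb := alternating_cycle_injb cyc.
have [minO bR bL injL injR] := cyc.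
have [/minsetp /stable_setP[O0 fO] injf] := (minO, minset_stable_inj minO).
have CL e : (e \in O) || (e \in b @: O) -> exists2 p, p \in O & L e = L p.
  case/orP => [eO|/imsetP[x xO ->]]; first by exists e.
  by exists (f x); rewrite ?fO ?bL.
have CR e : (e \in O) || (e \in b @: O) -> exists2 p, p \in O & R e = R p.
  case/orP => [eO|/imsetP[x xO ->]]; first by exists e.
  by exists x; rewrite ?bR.
have a'C j : 0 < a' j -> (j \in O) || (j \in b @: O).
  (* [a'] has the degrees of [a], so its edges end on the cycle; having no chord puts them in it. *)
  move=> a'j; have := vdeg_gt0 L a'j; rewrite -hL => /vdeg_gt0P[k /aC/CL[p pO ->] pj].
  have := vdeg_gt0 R a'j; rewrite -hR => /vdeg_gt0P[k' /aC/CR[q qO ->] qj].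
  exact: (nochord p q).
have Ob x y : x \in O -> y \in O -> x != b y.
  move=> xO yO; apply/eqP => e; have := disjointFr dis xO.
  by rewrite e imset_f.
have degR (c : 'X_{1..m}) x :
    (forall j, 0 < c j -> (j \in O) || (j \in b @: O)) -> x \in O ->
    vdeg R c (R x) = c x + c (b x).
  move=> cC xO; apply: vdeg_two; rewrite ?Ob ?bR // => j /cC /orP[jO|].
    by move/injR => ->; auto.
  by case/imsetP => y yO ->; rewrite bR // => /injR ->; auto.
have degL (c : 'X_{1..m}) x :
    (forall j, 0 < c j -> (j \in O) || (j \in b @: O)) -> x \in O ->
    vdeg L c (L (f x)) = c (f x) + c (b x).
  move=> cC xO; have fxO := fO x xO.
  apply: vdeg_two; rewrite ?Ob ?bL // => j /cC /orP[jO|].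
    by move/injL => ->; auto.
  case/imsetP => y yO ->; rewrite bL // => /injL; rewrite !fO // => /(_ isT isT).
  by move/injf => ->; auto.
have [x0 x0O] := set0Pn _ O0.
pose D : int := ((a x0)%:Z - (a' x0)%:Z)%R.
have DO : [set x in O | ((a x)%:Z - (a' x)%:Z == D)%R] = O.
  apply: (minset_stable_sub minO).
  - by apply/subsetP => x; rewrite inE => /andP[].
  - by apply/set0Pn; exists x0; rewrite inE x0O eqxx.
  move=> x; rewrite !inE => /andP[xO /eqP Dx]; rewrite fO //=; apply/eqP.
  (* The degrees at [R x] and [L (f x)] share the term in [b x], so subtracting them gives
     invariance under [f]. *)
  have := hR (R x); have := hL (L (f x)); rewrite !degR // !degL //; lia.
have aD x : x \in O -> ((a x)%:Z - (a' x)%:Z = D)%R.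
  by rewrite -{1}DO inE => /andP[_ /eqP].
exists D => j; rewrite !msetE // imset_id.
case: (boolP (j \in O)) => jO.
  by rewrite (disjointFr dis jO) aD //= subr0 mulr1.
case: (boolP (j \in b @: O)) => jbO.
  case/imsetP: jbO => x xO ->.
  have := hR (R x); rewrite !degR //; have := aD x xO; lia.
have C0 (w : 'X_{1..m}) :
    (forall i, 0 < w i -> (i \in O) || (i \in b @: O)) -> w j = 0.
  move=> wC; apply/eqP; rewrite -leqn0 leqNgt; apply/negP => /wC.
  by rewrite (negPf jO) (negPf jbO).
rewrite (C0 a) // (C0 a') //.
by rewrite !subr0 mulr0.
Qed.

(** The first alternative feeds an induction on the degree; the second is the case of a chordless
    cycle with halves [u] and [v]. *)
Lemma fiber_dichotomy (T : finType) (m : nat) (L R : 'I_m -> T)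
    (u v : 'X_{1..m}) :
    (forall i j, L i = L j -> R i = R j -> i = j) ->
    same_deg L R u v -> u != 0%MM ->
  (exists w, exists i, exists j,
     same_deg L R u w /\ [/\ 0 < u i, 0 < w i, 0 < w j & 0 < v j]) \/
  (forall a a' : 'X_{1..m}, (forall j, 0 < a j -> 0 < u j + v j) ->
     same_deg L R a a' ->
     exists D : int, forall j : 'I_m,
       ((a j)%:Z - (a' j)%:Z = D * ((u j)%:Z - (v j)%:Z))%R).
Proof.
move=> injLR huv u0.
case: (boolP [exists j, (0 < u j) && (0 < v j)]) => [/existsP[j /andP[uj vj]]|].
  by left; exists u, j, j; split.
rewrite negb_exists => /forallP nshare.
have [O [b [f [cyc uO vO]]]] := exists_alternating_cycle huv u0.
have injb := alternating_cycle_injb cyc.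
have cdeg := alternating_cycle_same_deg cyc.
have [minO bR bL injL injR] := cyc.
have [x0 x0O] : exists x, x \in O.
  by have /minsetp /andP[/set0Pn] := minO.
have leO : (mset O id <= u)%MM.
  apply/mnm_lepP => j; rewrite msetE // imset_id; case: (boolP (j \in O)) => //.
  exact: uO.
have leb : (mset O b <= v)%MM.
  apply/mnm_lepP => j; rewrite msetE //.
  by case: imsetP => // -[x xO ->]; apply: vO.
have uE := submK leO; have vE := submK leb.
have [uO0|uO0] := eqVneq (u - mset O id)%MM 0%MM; last first.
  have [i ui] : exists i, 0 < (u - mset O id)%MM i.
    apply/existsP; apply: contraNT uO0; rewrite negb_exists => /forallP h.
    by apply/eqP/mnmP => j; rewrite mnm0E; have := h j; lia.
  (* Exchanging [O] for its partner matching keeps the leftover edge [i] of [u] and brings in the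
     edge [b x0] of [v]. *)
  left; exists (u - mset O id + mset O b)%MM, i, (b x0); split.
    by rewrite -{1}uE; apply/same_degDl.
  split; last exact: vO; first by move: ui; rewrite mnmBE; lia.
    by rewrite mnmDE ltn_addr.
  by rewrite mnmDE addnC ltn_addr // mset_gt0.
have uS : mset O id = u by rewrite -uE uO0 add0m.
have vS : mset O b = v.
  (* Since [u] is the matching [O], [v] has the degrees of [mset O b], and the remainder has degree
     zero. *)
  suff v0 : (v - mset O b)%MM = 0%MM by rewrite -vE v0 add0m.
  apply: (@vdeg_eq0 _ _ L) => x.
  have := huv.1 x; rewrite -uS cdeg.1 -{1}vE vdegD; lia.
case: (boolP [exists p in O, exists q in O, exists e,
    [&& L e == L p, R e == R q, e \notin O & e \notin b @: O]]).
  case/exists_inP => p pO /exists_inP[q qO /existsP[e /and4P[/eqP Le /eqP Re eO ebO]]].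
  have [w [x xO [y yO [hw wx wy]]]] :=
    alternating_cycle_chord injLR cyc pO qO Le Re eO ebO.
  by left; exists w, x, (b y); rewrite -uS; split=> //; split=> //; rewrite ?uS ?uO ?vO.
move=> nochord; right => a a' aC haa'; rewrite -uS -vS.
apply: (alternating_cycle_kernel cyc) haa'.
- rewrite disjoint_subset; apply/subsetP => j jO; rewrite inE.
  apply/negP => /imsetP[x xO jx]; have := nshare j.
  by rewrite uO // jx vO.
- move=> p q e pO qO Le Re; apply: contraNT nochord; rewrite negb_or => ebO.
  apply/exists_inP; exists p => //; apply/exists_inP; exists q => //.
  by apply/existsP; exists e; rewrite Le Re !eqxx.
- move=> j /aC; rewrite -uS -vS !msetE // imset_id.
  by case: (j \in O); case: (j \in b @: O).
Qed.

(** * Fibres and membership in a toric ideal *)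

Local Open Scope ring_scope.

Definition config_deg (N d : nat) (A : config N d) (u : 'X_{1..N}) (k : 'I_d) : int :=
  \sum_(j < N) (u j)%:Z * A j k.

Lemma config_degD (N d : nat) (A : config N d) (u v : 'X_{1..N}) k :
  config_deg A (u + v)%MM k = config_deg A u k + config_deg A v k.
Proof.
by rewrite /config_deg -big_split; apply: eq_bigr => j _; rewrite mnmDE PoszD mulrDl.
Qed.

(** Lets sums over the supports of different polynomials be compared on one common list. *)
Lemma sum_msuppW (K : fieldType) (N : nat) (f : {mpoly K[N]}) (P : pred 'X_{1..N})
    (s : seq 'X_{1..N}) :
    uniq s -> {subset msupp f <= s} ->
  \sum_(u <- msupp f | P u) f@_u = \sum_(u <- s | P u) f@_u.
Proof.
move=> us sub; rewrite [RHS](bigID (mem (msupp f))) /= [X in _ + X]big1 ?addr0.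
  rewrite [RHS](eq_bigl (fun u => (u \in msupp f) && P u)); last first.
    by move=> u; rewrite andbC.
  rewrite -[RHS]big_filter_cond; apply: perm_big; apply: uniq_perm.
  - exact: msupp_uniq.
  - exact: filter_uniq.
  - by move=> u; rewrite mem_filter; case: (boolP (u \in msupp f)) => // /sub ->.
by move=> u /andP[_ /memN_msupp_eq0].
Qed.

Lemma toric_ideal0 (K : fieldType) (N d : nat) (A : config N d) :
  toric_ideal K A 0.
Proof. by move=> b; rewrite msupp0 big_nil. Qed.

Lemma toric_idealD (K : fieldType) (N d : nat) (A : config N d) f g :
  toric_ideal K A f -> toric_ideal K A g -> toric_ideal K A (f + g).
Proof.
move=> fA gA b; pose s := undup (msupp f ++ msupp g).
have us : uniq s by apply: undup_uniq.
rewrite (@sum_msuppW _ _ _ _ s) //; last by move=> u /msuppD_le; rewrite mem_undup.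
under eq_bigr do rewrite mcoeffD.
have fs : {subset msupp f <= s} by move=> u hu; rewrite mem_undup mem_cat hu.
have gs : {subset msupp g <= s} by move=> u hu; rewrite mem_undup mem_cat hu orbT.
by rewrite big_split /= -(sum_msuppW _ us fs) -(sum_msuppW _ us gs) fA gA addr0.
Qed.

Lemma toric_idealZ (K : fieldType) (N d : nat) (A : config N d) c f :
  toric_ideal K A f -> toric_ideal K A (c *: f).
Proof.
move=> fA b; rewrite (@sum_msuppW _ _ _ _ (msupp f)) ?msupp_uniq //; last first.
  exact: msuppZ_le.
by under eq_bigr do rewrite mcoeffZ; rewrite -mulr_sumr fA mulr0.
Qed.

Lemma toric_idealMX (K : fieldType) (N d : nat) (A : config N d) f t :
  toric_ideal K A f -> toric_ideal K A (f * 'X_[t]).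
Proof.
move=> fA b; rewrite (perm_big _ (msuppMX f t)) big_map.
under eq_bigr do rewrite mcoeffMX.
(* Multiplication by ['X_[t]] translates fibres by the degree of [t]. *)
rewrite -[RHS](fA (fun k => b k - config_deg A t k)); apply: eq_bigl => u.
apply: eq_forallb => k; rewrite -[X in X == b k]/(config_deg A (t + u)%MM k).
by rewrite config_degD addrC eq_sym -subr_eq eq_sym.
Qed.

Lemma toric_ideal_binomial (K : fieldType) (N d : nat) (A : config N d) u v :
  toric_ideal K A ('X_[u] - 'X_[v]) <-> config_deg A u =1 config_deg A v.
Proof.
have [<-|uv] := eqVneq u v; first by rewrite subrr; split=> // _; apply: toric_ideal0.
have sub : {subset msupp ('X_[u] - 'X_[v] : {mpoly K[N]}) <= [:: u; v]}.
  by move=> w /msuppB_le; rewrite !msuppX.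
have us : uniq [:: u; v] by rewrite /= inE uv.
split=> [/(_ (config_deg A u))|uvA b]; rewrite (sum_msuppW _ us sub).
  (* The fibre of [u] has coefficient sum 1 unless it also contains [v]. *)
  rewrite !big_cons big_nil !mcoeffB !mcoeffX !eqxx eq_sym (negPf uv) addr0 subr0 sub0r.
  have -> : [forall k, \sum_j (u j)%:Z * A j k == config_deg A u k] by apply/forallP.
  case: forallP => [h _ k|_ /eqP]; first exact/esym/eqP/h.
  by rewrite addr0 oner_eq0.
rewrite !big_cons big_nil !mcoeffB !mcoeffX !eqxx eq_sym (negPf uv) addr0 subr0 sub0r.
have -> : [forall k, \sum_j (u j)%:Z * A j k == b k] =
          [forall k, \sum_j (v j)%:Z * A j k == b k].
  by apply: eq_forallb => k; have := uvA k; rewrite /config_deg => ->.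
case: ifP => h1; case: ifP => h2; rewrite ?subrr //.
  by have := etrans (esym h1) h2.
by have := etrans (esym h1) h2.
Qed.

Lemma toric_ideal_isolated (K : fieldType) (N d : nat) (A : config N d) f a :
    toric_ideal K A f -> (forall a', config_deg A a' =1 config_deg A a -> a' = a) ->
  f@_a = 0.
Proof.
move=> fA iso; have [af|/memN_msupp_eq0 //] := boolP (a \in msupp f).
have := fA (config_deg A a).
rewrite big_mkcond (bigD1_seq a) ?msupp_uniq //= big1 ?addr0 => [|a' na].
  by case: forallP => // -[] k.
case: forallP => // h; case/eqP: na; apply: iso => k; exact/eqP/h.
Qed.

(** Each monomial is compared with a representative of its fibre; the representatives cancel because
    the coefficients over a fibre sum to zero. *)
Lemma toric_ideal_span (K : fieldType) (N d : nat) (A : config N d)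
    (J : {mpoly K[N]} -> Prop) :
    J 0 -> (forall f g, J f -> J g -> J (f + g)) -> (forall c f, J f -> J (c *: f)) ->
    (forall u v, config_deg A u =1 config_deg A v -> J ('X_[u] - 'X_[v])) ->
  forall f, toric_ideal K A f -> J f.
Proof.
move=> J0 JD JZ JX f fA.
pose same u w := [forall k, config_deg A w k == config_deg A u k].
(* The first monomial of the support in the fibre of [u]; for [u] in the support the default is
   never reached. *)
pose rep u := nth u (msupp f) (find (same u) (msupp f)).
have hassame u : u \in msupp f -> has (same u) (msupp f).
  by move=> uf; apply/hasP; exists u => //; apply/forallP.
have repP u : u \in msupp f -> config_deg A u =1 config_deg A (rep u).
  by move=> uf k; have /forallP/(_ k)/eqP := nth_find u (hassame u uf).
have rep_eq u w : u \in msupp f -> w \in msupp f -> (rep u == rep w) = same w u.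
  move=> uf wf; apply/eqP/forallP => [e k|e].
    by rewrite (repP u) // e -repP.
  have suw : same u =1 same w.
    by move=> x; apply: eq_forallb => k; rewrite (eqP (e k)).
  rewrite /rep (eq_find suw); apply: set_nth_default.
  by rewrite -has_find hassame.
have -> : f = \sum_(u <- msupp f) f@_u *: ('X_[u] - 'X_[rep u]).
  under eq_bigr do rewrite scalerBr.
  rewrite big_split sumrN /= -mpolyE; set h := (X in _ - X).
  suff -> : h = 0 by rewrite subr0.
  apply/mpolyP => w; rewrite mcoeff0 raddf_sum /=.
  under eq_bigr do rewrite mcoeffZ mcoeffX.
  have [/hasP[u0 u0f /eqP <-]|/hasPn nw] := boolP (has (fun u => rep u == w) (msupp f)).
    rewrite -[RHS](fA (config_deg A u0)) big_seq [RHS]big_seq_cond [RHS]big_mkcondr /=.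
    apply: eq_bigr => u uf; rewrite rep_eq // -[[forall k, _]]/(same u0 u).
    by case: ifP => _; rewrite ?mulr1 ?mulr0.
  by rewrite big_seq big1 // => u /nw /negPf ->; rewrite mulr0.
rewrite big_seq; apply: big_ind => // u uf; apply/JZ/JX/repP => //.
Qed.

(** For nonnegative exponents the fibre condition describes the kernel of a map into a polynomial
    ring, hence a prime ideal. *)
Lemma toric_ideal_kernel (K : fieldType) (N d : nat) (A : config N d)
    (M : 'I_N -> 'X_{1..d}) f :
    (forall j k, A j k = (M j k)%:Z) ->
  toric_ideal K A f <-> f \mPo [tuple 'X_[M j] | j < N] = 0.
Proof.
move=> AM; pose Mu (u : 'X_{1..N}) := (\sum_(j < N) M j *+ u j)%MM.
have degE u k : config_deg A u k = (Mu u k)%:Z.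
  rewrite /config_deg mnm_sumE -natz natr_sum; apply: eq_bigr => j _.
  by rewrite AM mulmnE natz PoszM mulrC.
have coefE w : (f \mPo [tuple 'X_[M j] | j < N])@_w =
    \sum_(u <- msupp f | Mu u == w) f@_u.
  rewrite comp_mpolyEX raddf_sum /= [RHS]big_mkcond; apply: eq_bigr => u _.
  rewrite mcoeffZ comp_mpolyX.
  under eq_bigr do rewrite tnth_mktuple.
  by rewrite mprodXnE mcoeffX; case: ifP => _; rewrite ?mulr1 ?mulr0.
split=> [fA|f0 b].
  apply/mpolyP => w; rewrite coefE mcoeff0 -[RHS](fA (fun k => (w k)%:Z)).
  apply: eq_bigl => u; apply/eqP/forallP => [<- k|h]; first exact/eqP/degE.
  apply/mnmP => k; apply/eqP; have := h k.
  by rewrite -[X in X == _]/(config_deg A u k) degE.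
(* A nonnegative [b] is the exponent [w]; over a [b] with a negative entry the fibre is empty. *)
pose w := [multinom `|b k|%N | k < d].
have [/forallP b0|/forallPn[k bk]] := boolP [forall k, 0 <= b k].
  have := coefE w; rewrite f0 mcoeff0 => e; rewrite [RHS]e; apply: eq_bigl => u.
  apply/forallP/eqP => [h|uw k].
    apply/mnmP => k; rewrite mnmE -(eqP (h k)) -[X in `|X|%N]/(config_deg A u k).
    by rewrite degE.
  by rewrite -[X in X == _]/(config_deg A u k) degE uw mnmE; have := b0 k; lia.
rewrite big1 // => u /forallP/(_ k); rewrite -[X in X == _]/(config_deg A u k) degE.
by move/eqP => e; rewrite -e in bk.
Qed.

Lemma radical_toric_ideal (K : fieldType) (N d : nat) (A : config N d)
    (M : 'I_N -> 'X_{1..d}) f k :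
    (forall j i, A j i = (M j i)%:Z) ->
  toric_ideal K A (f ^+ k) -> toric_ideal K A f.
Proof.
move=> AM; rewrite !(toric_ideal_kernel _ AM) rmorphXn => /eqP.
by rewrite expf_eq0 => /andP[_ /eqP].
Qed.

(** * Sums of toric ideals *)

Lemma toric_sum0 (K : fieldType) (N s : nat) (d : 'I_s -> nat)
    (B : forall i, config N (d i)) :
  ideal_sum (fun i => toric_ideal K (B i)) 0.
Proof. by exists (fun=> 0); rewrite big1 //; split=> // i; apply: toric_ideal0. Qed.

Lemma toric_sumD (K : fieldType) (N s : nat) (d : 'I_s -> nat)
    (B : forall i, config N (d i)) f g :
  ideal_sum (fun i => toric_ideal K (B i)) f ->
  ideal_sum (fun i => toric_ideal K (B i)) g ->
  ideal_sum (fun i => toric_ideal K (B i)) (f + g).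
Proof.
move=> [F [FB ->]] [G [GB ->]]; exists (fun i => F i + G i); split.
  by move=> i; apply: toric_idealD.
by rewrite big_split.
Qed.

Lemma toric_sumZ (K : fieldType) (N s : nat) (d : 'I_s -> nat)
    (B : forall i, config N (d i)) c f :
  ideal_sum (fun i => toric_ideal K (B i)) f ->
  ideal_sum (fun i => toric_ideal K (B i)) (c *: f).
Proof.
move=> [F [FB ->]]; exists (fun i => c *: F i); rewrite scaler_sumr; split=> // i.
exact: toric_idealZ.
Qed.

Lemma toric_sumMX (K : fieldType) (N s : nat) (d : 'I_s -> nat)
    (B : forall i, config N (d i)) f t :
  ideal_sum (fun i => toric_ideal K (B i)) f ->
  ideal_sum (fun i => toric_ideal K (B i)) (f * 'X_[t]).
Proof.
move=> [F [FB ->]]; exists (fun i => F i * 'X_[t]); rewrite mulr_suml; split=> // i.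
exact: toric_idealMX.
Qed.

Lemma toric_sum_incl (K : fieldType) (N s : nat) (d : 'I_s -> nat)
    (B : forall i, config N (d i)) i f :
  toric_ideal K (B i) f -> ideal_sum (fun i => toric_ideal K (B i)) f.
Proof.
move=> fB; exists (fun j => if j == i then f else 0); split.
  by move=> j; case: eqP => [->|_] //; apply: toric_ideal0.
by rewrite -big_mkcond big_pred1_eq.
Qed.

Lemma toric_sum_sub (K : fieldType) (N s : nat) (d : 'I_s -> nat)
    (B : forall i, config N (d i)) (d' : nat) (A : config N d') f :
    (forall i g, toric_ideal K (B i) g -> toric_ideal K A g) ->
  ideal_sum (fun i => toric_ideal K (B i)) f -> toric_ideal K A f.
Proof.
move=> BA [F [FB ->]]; apply: big_ind => [|g h|i _]; first exact: toric_ideal0.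
  exact: toric_idealD.
exact: BA.
Qed.

Lemma msupp_exp_supported (K : fieldType) (N : nat) (C : pred 'I_N)
    (p : {mpoly K[N]}) k :
    (forall w, w \in msupp p -> forall j, (0 < w j)%N -> C j) ->
  forall w, w \in msupp (p ^+ k) -> forall j, (0 < w j)%N -> C j.
Proof.
move=> hp; elim: k => [|k IHk] w.
  by rewrite expr0 msupp1 inE => /eqP -> j; rewrite mnm0E.
rewrite exprS => /msuppM_le /allpairsP[[a c] /= [ap cp ->]] j.
by rewrite mnmDE addn_gt0 => /orP[]; [apply: hp ap j | apply: IHk cp j].
Qed.

(** * Degrees in a bipartite graph *)

Lemma bipartite_ends (n m : nat) (E : 'I_m -> {set 'I_n}) :
    simple_graph E -> bipartite_graph E ->
  exists (c : 'I_n -> bool) (L R : 'I_m -> 'I_n), forall j,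
    [/\ E j = [set L j; R j], c (L j) = false & c (R j) = true].
Proof.
move=> [E2 _] [c cE]; exists c.
suff /fin_all_exists[e eP] : forall j, exists p : 'I_n * 'I_n,
    [/\ E j = [set p.1; p.2], c p.1 = false & c p.2 = true].
  by exists (fun j => (e j).1), (fun j => (e j).2).
move=> j; have /eqP/cards2P[x [y [xy Ej]]] := E2 j.
have := cE j x y; rewrite Ej !inE !eqxx orbT => /(_ isT isT xy).
case cx: (c x); case cy: (c y) => // _; last by exists (x, y).
by exists (y, x); rewrite setUC.
Qed.

Lemma graph_config_deg (n m : nat) (E : 'I_m -> {set 'I_n}) (c : 'I_n -> bool)
    (L R : 'I_m -> 'I_n) :
    (forall j, [/\ E j = [set L j; R j], c (L j) = false & c (R j) = true]) ->
  forall u k, config_deg (graph_config E) u k =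
    (if c k then vdeg R u k else vdeg L u k)%:Z.
Proof.
move=> EP u k.
have -> : (if c k then vdeg R u k else vdeg L u k) = (\sum_(j | k \in E j) u j)%N.
  case ck: (c k); apply: eq_bigl => j; have [-> cL cR] := EP j; rewrite !inE.
    have -> : (k == L j) = false by apply/eqP => e; rewrite e cL in ck.
    by rewrite eq_sym.
  have -> : (k == R j) = false by apply/eqP => e; rewrite e cR in ck.
  by rewrite orbF eq_sym.
rewrite -natz natr_sum [RHS]big_mkcond; apply: eq_bigr => j _.
by rewrite /graph_config natz; case: ifP => _; rewrite ?mulr1 ?mulr0.
Qed.

Lemma graph_config_same_deg (n m : nat) (E : 'I_m -> {set 'I_n}) (c : 'I_n -> bool)
    (L R : 'I_m -> 'I_n) :
    (forall j, [/\ E j = [set L j; R j], c (L j) = false & c (R j) = true]) ->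
  forall u v, config_deg (graph_config E) u =1 config_deg (graph_config E) v <->
    same_deg L R u v.
Proof.
move=> EP u v.
(* [same_deg] compares both kinds of degree at every vertex; at a vertex of the other colour they
   vanish. *)
have vL w k : c k -> vdeg L w k = 0%N.
  by move=> ck; rewrite /vdeg big1 // => j /eqP e; have [_] := EP j; rewrite e ck.
have vR w k : ~~ c k -> vdeg R w k = 0%N.
  move=> ck; rewrite /vdeg big1 // => j /eqP e; have [_ _] := EP j.
  by rewrite e (negPf ck).
split=> [h|[hL hR] k]; last by rewrite !(graph_config_deg EP) hL hR.
split=> k; have := h k; rewrite !(graph_config_deg EP);
  by case: (boolP (c k)) => ck; [rewrite ?vL //|rewrite ?vR //] => -[].
Qed.

(** * From radical splittings to splittings *)

Lemma toric_sum_binomial (K : fieldType) (n m : nat) (E : 'I_m -> {set 'I_n})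
    (s : nat) (d : 'I_s -> nat) (B : forall i, config m (d i)) :
    simple_graph E -> bipartite_graph E ->
    (forall i f, toric_ideal K (B i) f -> toric_ideal K (graph_config E) f) ->
    (forall u v, config_deg (graph_config E) u =1 config_deg (graph_config E) v ->
       radical (ideal_sum (fun i => toric_ideal K (B i))) ('X_[u] - 'X_[v])) ->
  forall u v, config_deg (graph_config E) u =1 config_deg (graph_config E) v ->
    ideal_sum (fun i => toric_ideal K (B i)) ('X_[u] - 'X_[v]).
Proof.
move=> simE bipE BE radE.
have [c [L [R EP]]] := bipartite_ends simE bipE.
have degP := graph_config_same_deg EP.
have injLR i j : L i = L j -> R i = R j -> i = j.
  move=> eL eR; apply: simE.2.
  by have [-> _ _] := EP i; have [-> _ _] := EP j; rewrite eL eR.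
set J := ideal_sum _.
move=> u v /degP; have [k] := ubnP (mdeg u); elim: k u v => // k IHk u v.
rewrite ltnS => uk huv.
have [->|uv] := eqVneq u v; first by rewrite subrr; apply: toric_sum0.
(* A common variable is divided out, which lowers the degree and allows induction. *)
have share x y j : (mdeg x <= k)%N -> same_deg L R x y -> (0 < x j)%N -> (0 < y j)%N ->
    J ('X_[x] - 'X_[y]).
  move=> xk hxy xj yj.
  have lex : (U_(j) <= x)%MM by rewrite lep1mP -lt0n.
  have ley : (U_(j) <= y)%MM by rewrite lep1mP -lt0n.
  rewrite -(submK lex) -(submK ley) !mpolyXD -mulrBl; apply: toric_sumMX.
  apply: IHk; first by move: xk; rewrite -{1}(submK lex) mdegD mdeg1 addn1.
  by apply/(@same_degDl _ _ L R U_(j)%MM); rewrite ![(U_(j) + _)%MM]addmC !submK.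
have u0 : u != 0%MM.
  apply: contraNneq uv => u0; rewrite u0 eq_sym; apply/eqP.
  apply: (@vdeg_eq0 _ _ L) => x; rewrite -huv.1 u0 /vdeg big1 // => j _.
  by rewrite mnm0E.
have [[w [i [j [huw [ui wi wj vj]]]]]|ker] := fiber_dichotomy injLR huv u0.
  have degw : mdeg w = mdeg u.
    (* Each edge has exactly one [L]-end, so the [L]-degrees add up to the total degree. *)
    have degE x : mdeg x = (\sum_y vdeg L x y)%N.
      by rewrite mdegE (partition_big L xpredT).
    by rewrite !degE; apply: eq_bigr => x _; rewrite huw.1.
  rewrite -(subrKA 'X_[w]); apply: toric_sumD; first exact: (share _ _ i).
  apply: (share _ _ j) => //; first by rewrite degw.
  exact: same_deg_trans (same_deg_sym huw) huv.
case: (boolP [exists i, [forall k, config_deg (B i) u k == config_deg (B i) v k]]).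
  case/existsP => i /forallP h; apply: (@toric_sum_incl _ _ _ _ _ i).
  by apply/toric_ideal_binomial => l; apply/eqP.
rewrite negb_exists => /forallP nB; exfalso.
have /degP/radE[N JN] := huv.
have coef0 (a : 'X_{1..m}) : (forall j, (0 < a j)%N -> (0 < u j + v j)%N) ->
    (('X_[u] - 'X_[v]) ^+ N : {mpoly K[m]})@_a = 0.
  move=> aC; case: JN => F [FB ->]; rewrite raddf_sum big1 //= => i _.
  (* [a'] also lies in the graph fibre of [a], so [a - a'] is [D] times [u - v]; as [u - v] is
     outside the kernel of [B i], [D] is zero. *)
  apply: (toric_ideal_isolated (FB i)) => a' ha'.
  have /degP hdeg : config_deg (graph_config E) a =1 config_deg (graph_config E) a'.
    by apply/(@toric_ideal_binomial K)/(BE i)/toric_ideal_binomial => l; rewrite ha'.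
  have [D hD] := ker _ _ aC hdeg.
  have := nB i; rewrite negb_forall => /existsP[l nl].
  have : D * (config_deg (B i) u l - config_deg (B i) v l) = 0.
    apply/eqP; rewrite -(subrr (config_deg (B i) a l)) -{2}ha' eq_sym; apply/eqP.
    rewrite /config_deg -!sumrB mulr_sumr; apply: eq_bigr => j _.
    by rewrite -!mulrBl hD mulrA.
  move/eqP; rewrite mulf_eq0 subr_eq0 (negPf nl) orbF => /eqP D0.
  by apply/mnmP => j; have := hD j; rewrite D0 mul0r; lia.
have : ('X_[u] - 'X_[v] : {mpoly K[m]}) ^+ N != 0.
  rewrite expf_neq0 // subr_eq0; apply: contraNneq uv => /(congr1 (mcoeff v)) /eqP.
  by rewrite !mcoeffX eqxx; case: (u == v) => //; rewrite eq_sym oner_eq0.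
case/eqP; apply/mpolyP => a; rewrite mcoeff0.
have [af|/memN_msupp_eq0 //] := boolP (a \in msupp (('X_[K, u] - 'X_[v]) ^+ N)).
(* Powers of the binomial involve only the variables of [u] and [v]. *)
apply: coef0; move: a af.
apply: (@msupp_exp_supported K m (fun j => 0 < u j + v j)%N ('X_[u] - 'X_[v]) N).
move=> w /msuppB_le; rewrite !msuppX !inE => /orP[]/eqP -> j wj.
  by rewrite ltn_addr.
by rewrite addnC ltn_addr.
Qed.

Lemma has_splitting_radP (K : fieldType) (n m : nat) (E : 'I_m -> {set 'I_n}) s :
    simple_graph E -> bipartite_graph E ->
  has_splitting K (graph_config E) s <-> has_rad_splitting K (graph_config E) s.
Proof.
move=> simE bipE.
have natE j k : graph_config E j k = ([multinom (k \in E j : nat) | k < n] k)%:Z.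
  by rewrite mnmE /graph_config; case: ifP.
split=> -[s0 [d [B [posB [neqB eqB]]]]]; split=> //; exists d, B;
  split=> //; split=> // f.
  split=> [fE|[k /eqB]]; first by exists 1%N; apply/eqB.
  exact: radical_toric_ideal natE.
have BE i g : toric_ideal K (B i) g -> toric_ideal K (graph_config E) g.
  by move=> gB; apply/eqB; exists 1%N; apply: toric_sum_incl gB.
split; last exact: toric_sum_sub.
apply: toric_ideal_span => [|g h|a g|].
- exact: toric_sum0.
- exact: toric_sumD.
- exact: toric_sumZ.
apply: toric_sum_binomial => // u v uv.
by apply/eqB/toric_ideal_binomial.
Qed.

Theorem theorem3p1 (K : fieldType) (n m : nat) (E : 'I_m -> {set 'I_n})
    (Hsimple : simple_graph E) (Hconn : connected_graph E) (Hbip : bipartite_graph E) :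
  forall s : nat, Split_is K (graph_config E) s <-> Split_rad_is K (graph_config E) s.
Proof.
move=> s; have radP t := has_splitting_radP K t Hsimple Hbip.
by split=> -[hs mins]; split=> [|t ht]; [apply/radP|apply/mins/radP|
  apply/radP|apply/mins/radP].
Qed.
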